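(* Let $G$ be a group. Let $\|\cdot\|$ and $\|\cdot\|_{G^{ab}}$ be word norms generated by finitely many conjugacy classes on $G$ and on its abelianisation $G^{ab}=G/[G,G]$, respectively. Let $\omega$ be a non-principal ultrafilter on $\mathbb{N}$. Then there are homeomorphisms $$\mathrm{Cone}_\omega(G,\|\cdot\|)\cong\mathrm{Cone}_\omega([G,G],\|\cdot\|)\times\mathrm{Cone}_\omega(G^{ab},\|\cdot\|_{G^{ab}})\cong\mathrm{Cone}_\omega([G,G],\|\cdot\|)\times(\mathbb{R}^k,\ell_1),$$ where $k=\mathrm{rk}(G^{ab})$ and $[G,G]$ carries the restriction of $\|\cdot\|$.
   Context: A word norm generated by finitely many conjugacy classes on a group $G$ is $g\mapsto\min\{m\ge0\mid g=s_1\cdots s_m,\ s_i\in T\}$ where $T=T^{-1}$ is a generating set of $G$ which is a union of finitely many conjugacy classes. It is conjugation invariant and induces the metric $d(g,h)=\|gh^{-1}\|$. Asymptotic cone (scaling sequence $s_n=n$): a sequence $(x_n)_{n\ge1}$ in $G$ is admissible if $\|x_n\|/n$ is bounded; $\mathrm{Cone}_\omega(G,\|\cdot\|)$ is the set of admissible sequences modulo $(x_n)\sim(y_n)$ iff $\lim_\omega d(x_n,y_n)/n=0$, with the metric $\lim_\omega d(x_n,y_n)/n$. $\mathrm{rk}(G^{ab})$ is the rank of the (finitely generated) abelian group $G^{ab}$, i.e. $\dim_{\mathbb{Q}}(G^{ab}\otimes\mathbb{Q})$. *)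

(* Defs.v *)
From HB Require Import structures.
From mathcomp Require Import all_boot all_order all_algebra.
From mathcomp Require Import all_classical all_reals all_analysis.
Import Order.TTheory GRing.Theory Num.Theory.
Import numFieldNormedType.Exports.

Set Implicit Arguments.
Unset Strict Implicit.
Unset Printing Implicit Defensive.

Local Open Scope classical_set_scope.
Local Open Scope ring_scope.
Local Open Scope quotient_scope.

Section Subgroups.
Variable G : groupType.
Local Open Scope group_scope.

Definition is_subgroup (H : set G) : Prop :=
  [/\ H 1, (forall x y, H x -> H y -> H (x * y)) & (forall x, H x -> H x^-1)].

Definition generated (S : set G) : set G := smallest is_subgroup S.

Definition conj_class (x : G) : set G := [set x ^ g | g in [set: G]].

Definition derived : set G :=
  generated [set [~ x, y] | x in [set: G] & y in [set: G]].

Lemma generated_subgroup (S : set G) : is_subgroup (generated S).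
Proof.
split=> [H [[]]//|x y Sx Sy H HS|x Sx H HS].
- by case: (HS) => -[_ HM _] _; apply: HM; [exact: Sx|exact: Sy].
- by case: (HS) => -[_ _ HV] _; apply: HV; exact: Sx.
Qed.

Lemma sub_generated (S : set G) : S `<=` generated S.
Proof. by move=> x Sx H [_]; apply. Qed.

Lemma derived_group_closed :
  group_closed ((fun x => `[< derived x >]) : {pred G}).
Proof.
have [D1 DM DV] : is_subgroup derived by exact: generated_subgroup.
split; first by apply/asboolP.
by move=> x y /asboolP Dx /asboolP /DV Dy; apply/asboolP; exact: DM.
Qed.

Lemma commg_derived x y : derived [~ x, y].
Proof. by apply: sub_generated; exists x => //; exists y. Qed.

End Subgroups.

Section DerivedSubgroup.
Variable G : groupType.

Definition derived_subgroup : Type := {x : G | `[< derived x >]}.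

HB.instance Definition _ := SubChoice.on derived_subgroup.
HB.instance Definition _ :=
  SubChoice_isSubGroup.Build G _ derived_subgroup (@derived_group_closed G).

End DerivedSubgroup.

Section Abelianization.
Variable G : groupType.
Local Open Scope group_scope.

Definition derived_rel : rel G := fun x y => `[< derived (x * y^-1) >].

Lemma derived_relP : equiv_class_of derived_rel.
Proof.
have [D1 DM DV] : is_subgroup (@derived G) by exact: generated_subgroup.
have sym x y : derived_rel x y -> derived_rel y x.
  by move=> /asboolP /DV; rewrite invgF => ?; exact/asboolP.
split=> [x|x y|y x z].
- by apply/asboolP; rewrite mulgV.
- by apply/idP/idP; exact: sym.
- move=> /asboolP Dxy /asboolP Dyz; apply/asboolP.
  by have := DM _ _ Dxy Dyz; rewrite !mulgA mulgVK.
Qed.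

Canonical derived_equiv := EquivRelPack derived_relP.

Definition abelianization : Type := {eq_quot derived_rel}.

HB.instance Definition _ := Choice.on abelianization.
HB.instance Definition _ := EqQuotient.on abelianization.

Definition ab_proj (x : G) : abelianization := \pi_{eq_quot derived_rel} x.

Lemma ab_projP x y : ab_proj x = ab_proj y <-> derived (x * y^-1).
Proof.
split; first by move=> /eqquotP /asboolP.
by move=> D; apply/eqquotP/asboolP.
Qed.

Lemma ab_projK (a : abelianization) : ab_proj (repr a) = a.
Proof. exact: reprK. Qed.

Lemma derivedJ (x g : G) : derived x -> derived (x ^ g).
Proof.
have [_ DM _] : is_subgroup (@derived G) by exact: generated_subgroup.
move=> Dx; have -> : x ^ g = x * [~ x, g] by rewrite commgEl mulVKg.
by apply: DM => //; exact: commg_derived.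
Qed.

Definition ab_mul (a b : abelianization) := ab_proj (repr a * repr b).
Definition ab_inv (a : abelianization) := ab_proj (repr a)^-1.

Lemma ab_projM x y : ab_proj (x * y) = ab_mul (ab_proj x) (ab_proj y).
Proof.
have [_ DM DV] : is_subgroup (@derived G) by exact: generated_subgroup.
apply/ab_projP; set x' := repr _; set y' := repr _.
have Dx : derived (x * x'^-1) by apply/ab_projP; rewrite ab_projK.
have Dy : derived (y * y'^-1) by apply/ab_projP; rewrite ab_projK.
have -> : x * y * (x' * y')^-1 = (y * y'^-1) ^ x^-1 * (x * x'^-1).
  by rewrite conjgE invgK invgM !mulgA mulgVK.
by apply: DM => //; exact: derivedJ.
Qed.

Lemma ab_projV x : ab_proj x^-1 = ab_inv (ab_proj x).
Proof.
have [_ DM DV] : is_subgroup (@derived G) by exact: generated_subgroup.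
apply/ab_projP; set x' := repr _.
have Dx : derived (x' * x^-1) by apply/ab_projP; rewrite ab_projK.
have -> : x^-1 * (x'^-1)^-1 = (x' * x^-1) ^ x by rewrite conjgE mulgVK invgK.
exact: derivedJ.
Qed.

Lemma ab_mulA : associative ab_mul.
Proof.
move=> a b c; rewrite -(ab_projK a) -(ab_projK b) -(ab_projK c).
by rewrite -!ab_projM mulgA.
Qed.

Lemma ab_mul1 : left_id (ab_proj 1) ab_mul.
Proof. by move=> a; rewrite -(ab_projK a) -ab_projM mul1g. Qed.

Lemma ab_mulr1 : right_id (ab_proj 1) ab_mul.
Proof. by move=> a; rewrite -(ab_projK a) -ab_projM mulg1. Qed.

Lemma ab_mulV : left_inverse (ab_proj 1) ab_inv ab_mul.
Proof. by move=> a; rewrite -(ab_projK a) -ab_projV -ab_projM mulVg. Qed.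

Lemma ab_mulrV : right_inverse (ab_proj 1) ab_inv ab_mul.
Proof. by move=> a; rewrite -(ab_projK a) -ab_projV -ab_projM mulgV. Qed.

HB.instance Definition _ :=
  isGroup.Build abelianization ab_mulA ab_mul1 ab_mulr1 ab_mulV ab_mulrV.

End Abelianization.

Record conj_norm (G : groupType) := ConjNorm {
  cnorm :> G -> nat;
  cnorm1 : cnorm 1%g = 0%N;
  cnorm_eq0 : forall x, cnorm x = 0%N -> x = 1%g;
  cnormV : forall x, cnorm x^-1%g = cnorm x;
  cnormM : forall x y, (cnorm (x * y)%g <= cnorm x + cnorm y)%N;
  cnormJ : forall x g, cnorm (x ^ g)%g = cnorm x }.

Section RestrictedNorm.
Variables (G : groupType) (N : conj_norm G).

Let nrm (x : derived_subgroup G) : nat := N (val x).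

Let nrm1 : nrm 1%g = 0%N.
Proof. by rewrite /nrm val1 cnorm1. Qed.

Let nrm_eq0 x : nrm x = 0%N -> x = 1%g.
Proof. by move=> /cnorm_eq0 x1; apply: val_inj; rewrite x1 val1. Qed.

Let nrmV x : nrm x^-1%g = nrm x.
Proof. by rewrite /nrm -(cnormV N (val x)); congr (N _); exact: SubK. Qed.

Let nrmM x y : (nrm (x * y)%g <= nrm x + nrm y)%N.
Proof. by rewrite /nrm valM cnormM. Qed.

Let nrmJ x g : nrm (x ^ g)%g = nrm x.
Proof.
by rewrite /nrm -(cnormJ N (val x) (val g)); congr (N _).
Qed.

Definition restr_norm : conj_norm (derived_subgroup G) :=
  ConjNorm nrm1 nrm_eq0 nrmV nrmM nrmJ.

End RestrictedNorm.

Section WordNorm.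
Variable G : groupType.
Implicit Types T : set G.
Local Open Scope group_scope.

Definition fin_conj_gen T : Prop :=
  [/\ [set x^-1 | x in T] = T,
      generated T = [set: G] &
      exists2 F : set G, finite_set F & T = \bigcup_(x in F) conj_class x].

Definition word_of_length T (g : G) (m : nat) : Prop :=
  exists s : seq G,
    [/\ size s = m, (forall x, x \in s -> T x) & g = \prod_(x <- s) x].

Lemma fin_conj_genV T : fin_conj_gen T -> forall x, T x -> T x^-1.
Proof. by move=> [VT _ _] x Tx; rewrite -VT; exists x. Qed.

Lemma fin_conj_genJ T : fin_conj_gen T -> forall x g, T x -> T (x ^ g).
Proof.
move=> [_ _ [F _ ->]] x g [y Fy [h _ <-]]; exists y => //.
by exists (h * g) => //; rewrite conjgM.
Qed.

Lemma word_ofM T x y m n : word_of_length T x m -> word_of_length T y n ->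
  word_of_length T (x * y) (m + n)%N.
Proof.
move=> [s [<- sT ->]] [t [<- tT ->]]; exists (s ++ t).
rewrite size_cat big_cat; split=> // z.
by rewrite mem_cat => /orP[/sT|/tT].
Qed.

Lemma word_ofV T x m : fin_conj_gen T ->
  word_of_length T x m -> word_of_length T x^-1 m.
Proof.
move=> hT; case=> s [<-{m} + ->{x}]; elim: s => [|x s IHs] sT.
  by exists [::]; rewrite !big_nil invg1.
rewrite big_cons invgM /= -addn1; apply: word_ofM.
  by apply: IHs => z zs; apply: sT; rewrite inE zs orbT.
exists [:: x^-1]; rewrite big_seq1; split=> // z.
rewrite inE => /eqP ->; apply: fin_conj_genV => //.
by apply: sT; rewrite mem_head.
Qed.

Lemma word_ofJ T x g m : fin_conj_gen T ->
  word_of_length T x m -> word_of_length T (x ^ g) m.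
Proof.
move=> hT [s [<- sT ->]]; exists [seq z ^ g | z <- s].
rewrite size_map big_map conjg_prod; split=> // _ /mapP[z zs ->].
by apply: fin_conj_genJ => //; exact: sT.
Qed.

Lemma word_of_ex T (hT : fin_conj_gen T) (g : G) :
  exists m, `[< word_of_length T g m >].
Proof.
suff : generated T `<=` [set x | exists m, word_of_length T x m].
  have [_ -> _] := hT; move=> /(_ g I)[m wm].
  by exists m; apply/asboolP.
move=> x; apply; split; last first.
  move=> y Ty; exists 1%N, [:: y]; rewrite big_seq1; split=> // z.
  by rewrite inE => /eqP->.
split.
- by exists 0%N, [::]; rewrite big_nil.
- by move=> y z [m ym] [n zn]; exists (m + n)%N; exact: word_ofM.
- by move=> y [m ym]; exists m; exact: word_ofV.
Qed.

Section Norm.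
Variables (T : set G) (hT : fin_conj_gen T).

Let len (g : G) : nat := ex_minn (word_of_ex hT g).

Let len_min g m : word_of_length T g m -> (len g <= m)%N.
Proof. by rewrite /len; case: ex_minnP => k _ kmin ?; apply/kmin/asboolP. Qed.

Let lenP g : word_of_length T g (len g).
Proof. by rewrite /len; case: ex_minnP => k /asboolP. Qed.

Let len1 : len 1 = 0%N.
Proof.
by apply/eqP; rewrite -leqn0; apply: len_min; exists [::]; rewrite big_nil.
Qed.

Let len_eq0 x : len x = 0%N -> x = 1.
Proof.
by move=> x0; have [s [+ _ ->]] := lenP x; rewrite x0 => /size0nil ->; rewrite big_nil.
Qed.

Let lenV x : len x^-1 = len x.
Proof.
apply/eqP; rewrite eqn_leq len_min; last exact: word_ofV.
by rewrite -{1}[x]invgK len_min//; exact: word_ofV.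
Qed.

Let lenM x y : (len (x * y) <= len x + len y)%N.
Proof. by apply: len_min; exact: word_ofM. Qed.

Let lenJ x g : len (x ^ g) = len x.
Proof.
apply/eqP; rewrite eqn_leq len_min; last exact: word_ofJ.
by rewrite -{1}[x](conjgK g) len_min//; exact: word_ofJ.
Qed.

Definition word_norm : conj_norm G := ConjNorm len1 len_eq0 lenV lenM lenJ.

Lemma word_normP g : word_of_length T g (word_norm g) /\
  forall m, word_of_length T g m -> (word_norm g <= m)%N.
Proof. by split; [exact: lenP|exact: len_min]. Qed.

End Norm.
End WordNorm.

Section Cone.
Variables (R : realType) (omega : set_system nat).
Variable omega_ultra : UltraFilter omega.
Variables (G : groupType) (N : conj_norm G).

(* Sequences are indexed from 1 in the mathematics: the entry of index 0 is a *)
(* dummy, scaled to 0 since 0^-1 = 0 and invisible to a non-principal omega.  *)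
Definition scaled_norm (x : nat -> G) : nat -> R :=
  fun n => (N (x n))%:R / n%:R.

Definition scaled_dist (x y : nat -> G) : nat -> R :=
  scaled_norm (fun n => (x n * (y n)^-1)%g).

Definition admissible (x : nat -> G) : Prop :=
  exists C : R, forall n, (0 < n)%N -> scaled_norm x n <= C.

Definition adm_seq : Type := {x : nat -> G | `[< admissible x >]}.
HB.instance Definition _ := SubChoice.on adm_seq.

Definition seq_dist (x y : adm_seq) : R :=
  lim (scaled_dist (val x) (val y) @ omega).

Lemma scaled_dist_ge0 x y n : 0 <= scaled_dist x y n.
Proof. by rewrite divr_ge0. Qed.

Lemma scaled_distxx x n : scaled_dist x x n = 0.
Proof. by rewrite /scaled_dist /scaled_norm mulgV cnorm1 mul0r. Qed.

Lemma scaled_distC x y : scaled_dist x y = scaled_dist y x.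
Proof.
by apply/funext => n; rewrite /scaled_dist /scaled_norm -cnormV invgF.
Qed.

Lemma scaled_distD y x z n :
  scaled_dist x z n <= scaled_dist x y n + scaled_dist y z n.
Proof.
rewrite /scaled_dist /scaled_norm -mulrDl ler_wpM2r ?invr_ge0// -natrD ler_nat.
have -> : (x n / z n = (x n / y n) * (y n / z n))%g by rewrite !mulgA mulgVK.
exact: cnormM.
Qed.

Lemma scaled_dist_bounded (x y : adm_seq) :
  exists C : R, forall n, scaled_dist (val x) (val y) n <= C.
Proof.
case: x y => [x /= /asboolP[C xC]] [y /= /asboolP[D yD]].
exists (Num.max 0 (C + D)) => -[|n].
  by rewrite /scaled_dist /scaled_norm invr0 mulr0 le_max lexx.
rewrite le_max; apply/orP; right.
apply: le_trans (lerD (xC n.+1 isT) (yD n.+1 isT)).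
rewrite /scaled_dist /scaled_norm -mulrDl ler_wpM2r ?invr_ge0// -natrD ler_nat.
by rewrite -(cnormV N (y _)) cnormM.
Qed.

Lemma ultra_lim_cvg (u : nat -> R) (a b : R) :
  (forall n, a <= u n <= b) -> u @ omega --> lim (u @ omega).
Proof.
move=> uab.
have FU : UltraFilter (u @ omega).
  split=> [|F FF uF]; first exact: fmap_proper_filter.
  apply/seteqP; split=> // A FA.
  have [//|nA] := in_ultra_setVsetC (u @^-1` A) omega_ultra.
  have {}nA : F (~` A) by exact: uF.
  by have /filter_ex[? []] : F (A `&` ~` A) by exact: filterI.
have := @segment_compact R a b; rewrite compact_ultra => /(_ _ FU).
case=> [|l [_ ul]].
  rewrite /nbhs/=; apply: (@filterE _ omega) => n.
  by rewrite /= in_itv/=; exact: uab.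
by apply/cvg_ex; exists l.
Qed.

Lemma seq_dist_cvg (x y : adm_seq) :
  scaled_dist (val x) (val y) @ omega --> seq_dist x y.
Proof.
have [C xyC] := scaled_dist_bounded x y.
by apply: (@ultra_lim_cvg _ 0 C) => n; rewrite scaled_dist_ge0 xyC.
Qed.

Lemma seq_distxx x : seq_dist x x = 0.
Proof.
apply: cvg_lim => //.
rewrite (_ : scaled_dist _ _ = cst 0); first exact: cvg_cst.
by apply/funext => n; exact: scaled_distxx.
Qed.

Lemma seq_distC x y : seq_dist x y = seq_dist y x.
Proof. by rewrite /seq_dist scaled_distC. Qed.

Lemma seq_distD y x z : seq_dist x z <= seq_dist x y + seq_dist y z.
Proof.
have le_lim n : scaled_dist (val x) (val z) n <=
    scaled_dist (val x) (val y) n + scaled_dist (val y) (val z) n.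
  exact: scaled_distD.
have yD : (fun n => scaled_dist (val x) (val y) n +
    scaled_dist (val y) (val z) n) @ omega --> seq_dist x y + seq_dist y z.
  exact: cvgD (@seq_dist_cvg x y) (@seq_dist_cvg y z).
exact: (ler_cvg_to (@seq_dist_cvg x z) yD (@filterE _ omega _ _ le_lim)).
Qed.

Lemma seq_dist_ge0 x y : 0 <= seq_dist x y.
Proof.
have le_lim n : 0 <= scaled_dist (val x) (val y) n by exact: scaled_dist_ge0.
have c0 : (fun=> 0 : R) @ omega --> (0 : R) by exact: cvg_cst.
exact: (ler_cvg_to c0 (@seq_dist_cvg x y) (@filterE _ omega _ _ le_lim)).
Qed.

Definition cone_rel : rel adm_seq := fun x y => seq_dist x y == 0.

Lemma cone_relP : equiv_class_of cone_rel.
Proof.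
split=> [x|x y|y x z]; rewrite /cone_rel ?seq_distxx// 1?seq_distC//.
rewrite seq_distC => /eqP xy /eqP yz; rewrite eq_le seq_dist_ge0 andbT.
by rewrite (le_trans (seq_distD y x z))// xy yz addr0.
Qed.

Canonical cone_equiv := EquivRelPack cone_relP.

Definition Cone : Type := {eq_quot cone_rel}.
HB.instance Definition _ := Choice.on Cone.
HB.instance Definition _ := EqQuotient.on Cone.

Definition cone_proj (x : adm_seq) : Cone := \pi_{eq_quot cone_rel} x.

Definition cone_dist (p q : Cone) : R := seq_dist (repr p) (repr q).

Lemma cone_projP x y : cone_proj x = cone_proj y <-> seq_dist x y = 0.
Proof.
split; first by move=> /eqquotP /eqP.
by move=> /eqP xy; apply/eqquotP.
Qed.

Lemma cone_projK p : cone_proj (repr p) = p.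
Proof. exact: reprK. Qed.

Lemma cone_distE (x y : adm_seq) :
  cone_dist (cone_proj x) (cone_proj y) = seq_dist x y.
Proof.
have xr z : seq_dist (repr (cone_proj z)) z = 0.
  by apply/cone_projP; rewrite cone_projK.
have rx z : seq_dist z (repr (cone_proj z)) = 0 by rewrite seq_distC.
apply/eqP; rewrite eq_le; apply/andP; split.
- rewrite (le_trans (seq_distD x _ _))// xr add0r.
  by rewrite (le_trans (seq_distD y _ _))// rx addr0.
- rewrite (le_trans (seq_distD (repr (cone_proj x)) _ _))// rx add0r.
  by rewrite (le_trans (seq_distD (repr (cone_proj y)) _ _))// xr addr0.
Qed.

Lemma cone_distxx p : cone_dist p p = 0.
Proof. exact: seq_distxx. Qed.

Lemma cone_dist_eq0 p q : cone_dist p q = 0 -> p = q.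
Proof.
by move=> pq; rewrite -[p]cone_projK -[q]cone_projK; apply/cone_projP.
Qed.

Lemma cone_distC p q : cone_dist p q = cone_dist q p.
Proof. exact: seq_distC. Qed.

Lemma cone_distD q p r : cone_dist p r <= cone_dist p q + cone_dist q r.
Proof. exact: seq_distD. Qed.

HB.instance Definition _ :=
  isMetric.Build R Cone cone_distxx cone_dist_eq0 cone_distC cone_distD.

End Cone.

Section L1.
Variables (R : realType) (k : nat).

Definition l1space : Type := {ffun 'I_k -> R}.
HB.instance Definition _ := Choice.on l1space.

Definition l1_dist (x y : l1space) : R := \sum_(i < k) `|x i - y i|.

Lemma l1_distxx x : l1_dist x x = 0.
Proof. by apply: big1 => i _; rewrite subrr normr0. Qed.

Lemma l1_dist_eq0 x y : l1_dist x y = 0 -> x = y.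
Proof.
move=> /eqP; rewrite psumr_eq0// => /allP xy; apply/ffunP => i.
by apply/eqP; rewrite -subr_eq0 -normr_eq0; apply: xy; rewrite mem_index_enum.
Qed.

Lemma l1_distC x y : l1_dist x y = l1_dist y x.
Proof. by apply: eq_bigr => i _; rewrite distrC. Qed.

Lemma l1_distD y x z : l1_dist x z <= l1_dist x y + l1_dist y z.
Proof. by rewrite -big_split; apply: ler_sum => i _; exact: ler_distD. Qed.

HB.instance Definition _ :=
  isMetric.Build R l1space l1_distxx l1_dist_eq0 l1_distC l1_distD.

End L1.

(* The tensor product of A with rat over the integers, for a multiplicatively *)
(* written abelian group A: formal sums of symbols (a, q), modulo the         *)
(* congruence generated by bilinearity.                                       *)
Section TensorQ.
Variable A : groupType.
Implicit Types (s t u : seq (A * rat)).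

Inductive tens_eq : seq (A * rat) -> seq (A * rat) -> Prop :=
| TensRefl s : tens_eq s s
| TensSym s t : tens_eq s t -> tens_eq t s
| TensTrans t s u : tens_eq s t -> tens_eq t u -> tens_eq s u
| TensCat s s' t t' :
    tens_eq s s' -> tens_eq t t' -> tens_eq (s ++ t) (s' ++ t')
| TensC s t : tens_eq (s ++ t) (t ++ s)
| TensZero a : tens_eq [:: (a, 0)] [::]
| TensDl a b q : tens_eq [:: ((a * b)%g, q)] [:: (a, q); (b, q)]
| TensDr a p q : tens_eq [:: (a, p + q)] [:: (a, p); (a, q)].

Definition tens_rel : rel (seq (A * rat)) := fun s t => `[< tens_eq s t >].

Lemma tens_relP : equiv_class_of tens_rel.
Proof.
split=> [s|s t|t s u]; first exact/asboolP/TensRefl.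
- by apply/asboolP/asboolP; exact: TensSym.
- by move=> /asboolP st /asboolP tu; apply/asboolP; exact: TensTrans st tu.
Qed.

Canonical tens_equiv := EquivRelPack tens_relP.

Definition tensQ : Type := {eq_quot tens_rel}.
HB.instance Definition _ := Choice.on tensQ.
HB.instance Definition _ := EqQuotient.on tensQ.

Definition tclass s : tensQ := \pi_{eq_quot tens_rel} s.

Definition tens (a : A) (q : rat) : tensQ := tclass [:: (a, q)].

Lemma tclassP s t : tclass s = tclass t <-> tens_eq s t.
Proof.
split; first by move=> /eqquotP /asboolP.
by move=> st; apply/eqquotP/asboolP.
Qed.

Lemma tclassK v : tclass (repr v) = v.
Proof. exact: reprK. Qed.

Definition tscale_seq (c : rat) s := [seq (x.1, c * x.2) | x <- s].

Lemma tscale_seq_eq c s t :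
  tens_eq s t -> tens_eq (tscale_seq c s) (tscale_seq c t).
Proof.
elim=> {s t} [s|s t _ ?|t s u _ st _ tu|s s' t t' _ ss _ tt|s t|a|a b q|a p q].
- exact: TensRefl.
- exact: TensSym.
- exact: TensTrans st tu.
- by rewrite /tscale_seq !map_cat; exact: TensCat.
- by rewrite /tscale_seq !map_cat; exact: TensC.
- by rewrite /= mulr0; exact: TensZero.
- exact: TensDl.
- by rewrite /= mulrDr; exact: TensDr.
Qed.

Definition tadd (v w : tensQ) : tensQ := tclass (repr v ++ repr w).
Definition tscale (c : rat) (v : tensQ) : tensQ :=
  tclass (tscale_seq c (repr v)).
Definition topp (v : tensQ) : tensQ := tscale (-1) v.

Lemma taddE s t : tadd (tclass s) (tclass t) = tclass (s ++ t).
Proof. by apply/tclassP/TensCat; apply/tclassP; rewrite tclassK. Qed.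

Lemma tscaleE c s : tscale c (tclass s) = tclass (tscale_seq c s).
Proof. by apply/tclassP/tscale_seq_eq/tclassP; rewrite tclassK. Qed.

Lemma taddA : associative tadd.
Proof.
move=> u v w; rewrite -(tclassK u) -(tclassK v) -(tclassK w).
by rewrite !taddE catA.
Qed.

Lemma taddC : commutative tadd.
Proof.
move=> u v; rewrite -(tclassK u) -(tclassK v) !taddE.
exact/tclassP/TensC.
Qed.

Lemma tadd0 : left_id (tclass [::]) tadd.
Proof. by move=> u; rewrite -(tclassK u) taddE. Qed.

Lemma tscaleDl v : {morph tscale^~ v : c d / c + d >-> tadd c d}.
Proof.
move=> c d; rewrite -(tclassK v) !tscaleE taddE; apply/tclassP.
elim: (repr v) => [|[a q] s IHs] /=; first exact: TensRefl.
apply: (@TensTrans ([:: (a, c * q); (a, d * q)] ++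
  (tscale_seq c s ++ tscale_seq d s))).
  rewrite -cat1s; apply: TensCat => //.
  by rewrite mulrDl; exact: TensDr.
rewrite -[in X in tens_eq _ X]cat1s; apply: (@TensCat [:: _] [:: _]).
  exact: TensRefl.
rewrite -(cat1s (a, d * q) (tscale_seq d s)) -cat1s !catA.
by apply: TensCat; [exact: TensC|exact: TensRefl].
Qed.

Lemma tscale1 : left_id 1 tscale.
Proof.
move=> v; rewrite -{2}(tclassK v) /tscale; congr tclass.
by rewrite -[RHS]map_id; apply: eq_map => -[a q] /=; rewrite mul1r.
Qed.

Lemma tscale0 v : tscale 0 v = tclass [::].
Proof.
rewrite -(tclassK v) tscaleE; apply/tclassP.
elim: (repr v) => [|[a q] s IHs] /=; first exact: TensRefl.
rewrite mul0r; apply: (@TensCat [:: _] [::] _ [::]) => //.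
exact: TensZero.
Qed.

Lemma taddN : left_inverse (tclass [::]) topp tadd.
Proof. by move=> v; rewrite -{2}(tscale1 v) -tscaleDl addNr tscale0. Qed.

Lemma tscaleA c d v : tscale c (tscale d v) = tscale (c * d) v.
Proof.
rewrite -(tclassK v) !tscaleE /tscale_seq -map_comp; congr tclass.
by apply: eq_map => -[a q] /=; rewrite mulrA.
Qed.

Lemma tscaleDr : right_distributive tscale tadd.
Proof.
move=> c u v; rewrite -(tclassK u) -(tclassK v) taddE !tscaleE taddE.
by rewrite /tscale_seq map_cat.
Qed.

HB.instance Definition _ := GRing.isZmodule.Build tensQ taddA taddC tadd0 taddN.
HB.instance Definition _ := GRing.Zmodule_isLmodule.Build rat tensQ
  tscaleA tscale1 tscaleDr tscaleDl.

Lemma tensDl a b q : tens (a * b)%g q = tens a q + tens b q.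
Proof. by rewrite /tens [RHS]taddE; apply/tclassP/TensDl. Qed.

Lemma tensDr a p q : tens a (p + q) = tens a p + tens a q.
Proof. by rewrite /tens [RHS]taddE; apply/tclassP/TensDr. Qed.

Lemma tensZ c a q : c *: tens a q = tens a (c * q).
Proof. exact: tscaleE. Qed.

End TensorQ.

Definition is_basis (K : fieldType) (V : lmodType K) (k : nat)
    (b : 'I_k -> V) : Prop :=
  forall v : V, exists! c : {ffun 'I_k -> K}, v = \sum_(i < k) c i *: b i.

(* Junk value 0 for infinite-dimensional V. *)
Definition dimension (K : fieldType) (V : lmodType K) : nat :=
  xget 0%N [set k | exists b : 'I_k -> V, is_basis b].

Definition ab_rank (A : groupType) : nat := dimension (tensQ A : lmodType rat).

Definition homeomorphic (X Y : topologicalType) : Prop :=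
  exists (f : X -> Y) (g : Y -> X),
    [/\ continuous f, continuous g, cancel f g & cancel g f].

(* Main.v *)
(** Write A for the abelianization of G.  A maximal Z-independent subfamily
    s_1, ..., s_k of a finite generating set of A yields homomorphisms
    f_1, ..., f_k : A -> R with f_i(s_j) = delta_ij, and every element of A is
    an integer combination of the s_i up to finitely many residues.  Since the
    f_i are constant on conjugacy classes, they are Lipschitz for the word norm.
    Lifting s_i to a_i in G, the map
      (c, v) |-> [n |-> c_n * a_1^floor(n v_1) * ... * a_k^floor(n v_k)]
    from Cone([G,G]) x R^k to Cone(G) is bi-Lipschitz because the norm is
    conjugation invariant.  It is onto: the v_i of a given [x_n] are the
    ultralimits of f_i(x_n)/n, and x_n times the inverse of the product of the
    a_i^floor(n v_i) is at distance o(n) from [G,G], because norms in A are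
    controlled by the f_i up to a constant.  The same argument applied to A,
    whose derived subgroup is trivial, identifies Cone(A) with R^k. *)

From HB Require Import structures.
Require Import Defs.
From mathcomp Require Import all_boot all_order all_algebra.
From mathcomp Require Import all_classical all_reals all_analysis.
From mathcomp Require Import ring lra zify.

Set Implicit Arguments.
Unset Strict Implicit.
Unset Printing Implicit Defensive.

Local Open Scope classical_set_scope.

Import Order.TTheory GRing.Theory Num.Theory.
Import numFieldNormedType.Exports.

(** * Powers and ultralimits *)

Section IntegerPowers.
Variable G : groupType.
Implicit Types g : G.

Definition zpow g (z : int) : G :=
  match z with Posz n => (g ^+ n)%g | Negz n => ((g ^+ n.+1)^-1)%g end.

Lemma zpow_subn g (m n : nat) :
  zpow g (m%:Z - n%:Z)%R = (g ^+ m * (g ^+ n)^-1)%g.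
Proof.
case: (leqP n m) => [nm|/ltnW mn].
  by rewrite subzn//= expgnFr.
have -> : (m%:Z - n%:Z = - (n - m)%N%:Z)%R by rewrite -subzn// opprB.
have -> : zpow g (- (n - m)%N%:Z) = ((g ^+ (n - m))^-1)%g.
  by case: (n - m)%N => [|k]; rewrite ?invg1.
by rewrite expgnFr// invgF.
Qed.

Lemma intE_subn (z : int) : exists m n : nat, z = (m%:Z - n%:Z)%R.
Proof. by case: z => n; [exists n, 0%N|exists 0%N, n.+1]; lia. Qed.

(** Powers of one element commute, so writing both exponents as differences of naturals leaves only
    natural powers to rearrange. Hence rounding an exponent differently costs a bounded multiple of
    the norm of [g]. *)
Lemma zpowB g (y z : int) : zpow g (y - z)%R = (zpow g y * (zpow g z)^-1)%g.
Proof.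
have [m [n ->]] := intE_subn y; have [p [q ->]] := intE_subn z.
have -> : (m%:Z - n%:Z - (p%:Z - q%:Z) = (m + q)%N%:Z - (n + p)%N%:Z)%R by lia.
have ngq : ((g ^+ n)^-1 * g ^+ q = g ^+ q * (g ^+ n)^-1)%g.
  by apply/commute_sym/commuteV/commuteX2.
rewrite !zpow_subn expgnDr [(n + p)%N]addnC expgnDr !invgM invgK !mulgA.
by rewrite -(mulgA (g ^+ m)%g (_^-1)%g) ngq !mulgA.
Qed.

Lemma cnormX (N : conj_norm G) g n : (N (g ^+ n)%g <= n * N g)%N.
Proof.
elim: n => [|n IHn]; first by rewrite expg0 cnorm1.
by rewrite expgS (leq_trans (cnormM _ _ _))// mulSn leq_add2l.
Qed.

Lemma cnorm_zpow (N : conj_norm G) g z : (N (zpow g z) <= `|z| * N g)%N.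
Proof. by case: z => n /=; rewrite ?cnormV cnormX. Qed.

End IntegerPowers.

Section NonprincipalLimits.
Variables (R : realType) (omega : set_system nat).
Variable omega_ultra : UltraFilter omega.
Hypothesis omega_nonprincipal : forall n : nat, omega <> principal_filter n.
Local Open Scope ring_scope.

(** An ultrafilter containing a singleton is principal, so [omega] contains the complement of each
    singleton and, by finite intersections, every tail. *)
Lemma nonprincipal_cofinite : omega --> \oo.
Proof.
have nsing n : ~ omega [set n].
  move=> on; apply: (@omega_nonprincipal n).
  apply/seteqP; split=> A /= oA; last exact: filterS on.
  have /filter_ex[m [/= -> An]] : omega ([set n] `&` A) by exact: filterI.
  by move=> _ ->.
move=> A [n _ nA]; apply: filterS nA _.
elim: n => [|n IHn]; first exact: filterS filterT.
have : omega (~` [set n]).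
  by have [/nsing|] := in_ultra_setVsetC [set n] omega_ultra.
move=> /(filterI IHn); apply: filterS => m [/= nm /eqP mn].
by rewrite ltn_neqAle eq_sym mn.
Qed.

Lemma cvg_over_index (a : R) : (fun n : nat => a / n%:R) @ omega --> (0 : R).
Proof.
have : (fun n : nat => a / n%:R) @ \oo --> (0 : R).
  rewrite -[X in _ --> X](mulr0 a); apply: cvgM; first exact: cvg_cst.
  apply/gtr0_cvgV0; last first.
    exact: cvgr_idn.
  by exists 1%N => // n /= n0; rewrite ltr0n.
by move=> h; apply: cvg_trans h; apply: cvg_app; exact: nonprincipal_cofinite.
Qed.

(** Common limit argument of the distance estimates: [A / n] collects the rounding errors of the
    floors, and the dummy index 0 is excluded. *)
Lemma le_ultralimit (u w : nat -> R) (b A l l' : R) :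
    (forall n, (0 < n)%N -> u n <= w n + b + A / n%:R) ->
  u @ omega --> l -> w @ omega --> l' -> l <= l' + b.
Proof.
move=> uw ul wl.
have wl' : (fun n => w n + b + A / n%:R) @ omega --> l' + b + 0.
  apply: cvgD; last exact: cvg_over_index.
  by apply: cvgD => //; exact: cvg_cst.
rewrite -[leRHS]addr0; apply: ler_cvg_to ul wl' _.
by apply: nonprincipal_cofinite; exists 1%N => // n /= /uw.
Qed.

End NonprincipalLimits.

(** * Bi-Lipschitz homeomorphisms *)

Section Homeomorphisms.

Lemma homeomorphic_sym (X Y : topologicalType) :
  homeomorphic X Y -> homeomorphic Y X.
Proof. by move=> [f [g [cf cg fK gK]]]; exists g, f. Qed.

Lemma homeomorphic_trans (Y X Z : topologicalType) :
  homeomorphic X Y -> homeomorphic Y Z -> homeomorphic X Z.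
Proof.
move=> [f [f' [cf cf' fK f'K]]] [g [g' [cg cg' gK g'K]]].
exists (g \o f), (f' \o g'); split.
- by move=> x; apply: continuous_comp; [exact: cf|exact: cg].
- by move=> x; apply: continuous_comp; [exact: cg'|exact: cf'].
- exact: can_comp.
- exact: can_comp.
Qed.

Lemma homeomorphic_prodr (X Y Z : topologicalType) :
  homeomorphic Y Z -> homeomorphic (X * Y)%type (X * Z)%type.
Proof.
move=> [f [f' [cf cf' fK f'K]]].
exists (fun p => (p.1, f p.2)), (fun p => (p.1, f' p.2)); split.
- move=> p; apply: cvg_pair; first exact: cvg_fst.
  by apply: continuous_comp; [exact: cvg_snd|exact: cf].
- move=> p; apply: cvg_pair; first exact: cvg_fst.
  by apply: continuous_comp; [exact: cvg_snd|exact: cf'].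
- by move=> [x y] /=; rewrite fK.
- by move=> [x y] /=; rewrite f'K.
Qed.

Lemma homeomorphic_prod_point (X Y : topologicalType) (x0 : X) :
  (forall x, x = x0) -> homeomorphic (X * Y)%type Y.
Proof.
move=> x0E; exists snd, (fun y => (x0, y)); split=> //.
- by move=> p; exact: cvg_snd.
- by move=> y; apply: cvg_pair; [exact: cvg_cst|exact: cvg_id].
- by move=> [x y] /=; rewrite (x0E x).
Qed.

Local Open Scope ring_scope.

Lemma lipschitz_continuous (R : realType) (X Y : metricType R) (f : X -> Y)
    (C : R) :
  (forall x y, mdist (f x) (f y) <= C * mdist x y) -> continuous f.
Proof.
move=> fC x; apply/cvg_ballP => e e0.
(* [C] may be zero or negative; [|C| + 1] is a positive Lipschitz constant by which one can
   divide. *)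
have K0 : 0 < `|C| + 1 by rewrite ltr_wpDl.
near=> y; rewrite ballEmdist /=.
have : ball x (e / (`|C| + 1)) y.
  by near: y; apply: nbhsx_ballx; rewrite divr_gt0.
rewrite ballEmdist /= ltr_pdivlMr// mulrC; apply: le_lt_trans.
apply: le_trans (fC x y) _; rewrite ler_wpM2r ?mdist_ge0//.
by rewrite (le_trans (ler_norm _))// lerDl.
Unshelve. all: by end_near. Qed.

(** Surjectivity gives a section [Psi] by choice; the two lower bounds make [Phi] injective, so
    [Psi] is a two-sided inverse, and they also make both components of [Psi] Lipschitz. *)
Lemma bilipschitz_homeomorphic (R : realType) (X Y Z : metricType R)
    (Phi : X * Y -> Z) (C : R) :
    (forall p q, mdist (Phi p) (Phi q) <=
                   C * (mdist p.1 q.1 + mdist p.2 q.2)) ->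
    (forall p q, mdist p.1 q.1 <= C * mdist (Phi p) (Phi q)) ->
    (forall p q, mdist p.2 q.2 <= C * mdist (Phi p) (Phi q)) ->
    (forall z, exists p, Phi p = z) ->
  homeomorphic Z (X * Y)%type.
Proof.
move=> Phi_lip inv1 inv2 /choice[Psi PsiK].
have PhiK : cancel Phi Psi.
  move=> p; have P0 : mdist (Phi (Psi (Phi p))) (Phi p) = 0.
    by rewrite PsiK mdistxx.
  have h1 := inv1 (Psi (Phi p)) p; have h2 := inv2 (Psi (Phi p)) p.
  rewrite [X in _ <= X](_ : _ = 0) in h1; last by rewrite P0 mulr0.
  rewrite [X in _ <= X](_ : _ = 0) in h2; last by rewrite P0 mulr0.
  rewrite [LHS]surjective_pairing [RHS]surjective_pairing; congr (_, _);
    by apply: mdist_positivity; apply/eqP; rewrite eq_le mdist_ge0 andbT.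
exists Psi, Phi; split => //.
- have c1 : continuous (fst \o Psi).
    apply: (@lipschitz_continuous _ _ _ _ C) => z z'.
    by rewrite /= (le_trans (inv1 _ _))// !PsiK.
  have c2 : continuous (snd \o Psi).
    apply: (@lipschitz_continuous _ _ _ _ C) => z z'.
    by rewrite /= (le_trans (inv2 _ _))// !PsiK.
  have -> : Psi = fun z => ((fst \o Psi) z, (snd \o Psi) z).
    by apply/funext => z /=; case: (Psi z).
  by move=> z; apply: cvg_pair; [exact: c1|exact: c2].
- move=> p; apply/cvg_ballP => e e0.
  (* Each factor moves by less than [d], so the sum of the two distances stays below
     [e / (|C| + 1)]. *)
  pose d := e / (2 * (`|C| + 1)).
  have K0 : 0 < `|C| + 1 by rewrite ltr_wpDl.
  have d0 : 0 < d by rewrite divr_gt0// mulr_gt0.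
  near=> q; rewrite ballEmdist /=.
  have q1 : ball p.1 d q.1.
    by near: q; apply: (@cvg_fst _ _ _ _ (nbhs_filter p.2)); exact: nbhsx_ballx.
  have q2 : ball p.2 d q.2.
    by near: q; apply: (@cvg_snd _ _ (nbhs p.1)); exact: nbhsx_ballx.
  move: q1 q2; rewrite !ballEmdist /= => q1 q2.
  apply: le_lt_trans (Phi_lip p q) _.
  apply: (@le_lt_trans _ _ ((`|C| + 1) * (mdist p.1 q.1 + mdist p.2 q.2))).
    rewrite ler_wpM2r ?addr_ge0 ?mdist_ge0//.
    by rewrite (le_trans (ler_norm _))// lerDl.
  rewrite mulrC -ltr_pdivlMr//.
  have -> : e / (`|C| + 1) = d + d.
    by rewrite /d; field; rewrite gt_eqF.
  exact: ltrD.
Unshelve. all: by end_near. Qed.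

End Homeomorphisms.

(** * Splitting the cone over the derived subgroup *)

Section NormedProducts.
Variables (G : groupType) (N : conj_norm G).
Local Open Scope group_scope.

(** The quotient of the second factors occurs only conjugated, by [x'^-1], which the invariant norm
    does not see. *)
Lemma cnorm_mulB (x y x' y' : G) :
  (N (x * y * (x' * y')^-1)%g <= N (x * x'^-1)%g + N (y * y'^-1)%g)%N.
Proof.
have -> : x * y * (x' * y')^-1 = x * x'^-1 * (y * y'^-1) ^ x'^-1.
  by rewrite conjgE invgM invgK !mulgA mulgVK.
by rewrite (leq_trans (cnormM _ _ _))// cnormJ.
Qed.

Lemma cnorm_prod I (r : seq I) (x : I -> G) :
  (N (\prod_(i <- r) x i)%g <= \sum_(i <- r) N (x i))%N.
Proof.
elim: r => [|i r IHr]; first by rewrite !big_nil cnorm1.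
by rewrite !big_cons (leq_trans (cnormM _ _ _))// leq_add2l.
Qed.

Lemma cnorm_prodB I (r : seq I) (x y : I -> G) :
  (N ((\prod_(i <- r) x i) * (\prod_(i <- r) y i)^-1)%g <=
     \sum_(i <- r) N (x i * (y i)^-1)%g)%N.
Proof.
elim: r => [|i r IHr]; first by rewrite !big_nil mulgV cnorm1.
by rewrite !big_cons (leq_trans (cnorm_mulB _ _ _ _))// leq_add2l.
Qed.

End NormedProducts.

Section RealHomomorphisms.
Variables (R : realType) (G : groupType) (f : G -> R).
Local Open Scope ring_scope.
Hypothesis fM : forall x y, f (x * y)%g = f x + f y.

Lemma real_hom1 : f 1%g = 0.
Proof. by apply: (addrI (f 1%g)); rewrite -fM mulg1 addr0. Qed.

Lemma real_homV x : f x^-1%g = - f x.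
Proof. by apply/eqP; rewrite -addr_eq0 -fM mulVg real_hom1. Qed.

Lemma real_homB x y : f (x * y^-1)%g = f x - f y.
Proof. by rewrite fM real_homV. Qed.

Lemma real_homJ x y : f (x ^ y)%g = f x.
Proof. by rewrite conjgE !fM real_homV addrCA addNr addr0. Qed.

Lemma real_hom_prod I (r : seq I) (x : I -> G) :
  f (\prod_(i <- r) x i)%g = \sum_(i <- r) f (x i).
Proof. exact: (big_morph f fM real_hom1). Qed.

Lemma real_hom_zpow g z : f (zpow g z) = z%:~R * f g.
Proof.
have fX n : f (g ^+ n)%g = n%:R * f g.
  elim: n => [|n IHn]; first by rewrite expg0 real_hom1 mul0r.
  by rewrite expgS fM IHn -natr1; ring.
by case: z => n /=; rewrite ?real_homV fX // NegzE mulrNz mulNr.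
Qed.

(** The kernel of [f] is a subgroup containing all commutators, and [derived] is the smallest such
    subgroup. *)
Lemma real_hom_derived x : derived x -> f x = 0.
Proof.
move=> Dx; apply: (Dx [set y | f y = 0]); split; last first.
  by move=> _ [y _ [z _ <-]]; rewrite /= commgEl fM real_homV real_homJ addNr.
split=> [|y z /= fy fz|y /= fy] /=; first exact: real_hom1.
- by rewrite fM fy fz addr0.
- by rewrite real_homV fy oppr0.
Qed.

End RealHomomorphisms.

(** * The bi-Lipschitz parametrisation of the cone by dual coordinates *)

Section ConeSplitting.
Variables (R : realType) (omega : set_system nat).
Variable omega_ultra : UltraFilter omega.
Hypothesis omega_nonprincipal : forall n : nat, omega <> principal_filter n.
Variables (H : groupType) (N : conj_norm H) (k : nat).
Variables (f : 'I_k -> H -> R) (a : 'I_k -> H) (C : R).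
Local Open Scope ring_scope.
Hypothesis fM : forall i x y, f i (x * y)%g = f i x + f i y.
Hypothesis fa : forall i j, f i (a j) = (i == j)%:R.
Hypothesis C_ge0 : 0 <= C.
Hypothesis fN : forall i x, `|f i x| <= C * (N x)%:R.
(** The coordinates control the distance to the derived subgroup up to a constant; the summand 1
    leaves room for finitely many residues. *)
Hypothesis near_derived : forall x, exists w,
  derived (x * w^-1)%g /\ (N w)%:R <= C * (1 + \sum_i `|f i x|).

Let D := restr_norm N.
Let A : R := \sum_i (N (a i))%:R.

Let A_ge0 : 0 <= A. Proof. by rewrite sumr_ge0. Qed.

(** A discrete ray in direction [v]; the [a i] need not commute, so the product is taken in a fixed
    order. *)
Definition lattice_seq (v : l1space R k) (n : nat) : H :=
  (\prod_(i < k) zpow (a i) (Num.floor (n%:R * v i)))%g.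

Lemma coord_lattice_seq i v n :
  f i (lattice_seq v n) = (Num.floor (n%:R * v i))%:~R.
Proof.
rewrite (real_hom_prod (fM i)) (bigD1 i)//= big1 => [|j ji].
  by rewrite (real_hom_zpow (fM i)) fa eqxx mulr1 addr0.
by rewrite (real_hom_zpow (fM i)) fa eq_sym (negPf ji) mulr0.
Qed.

Lemma floor_dist (x y : R) :
  `|(Num.floor x)%:~R - (Num.floor y)%:~R| <= `|x - y| + 1 :> R.
Proof.
have := floor_le_tmp x; have := floorD1_gt x.
have := floor_le_tmp y; have := floorD1_gt y; rewrite !intrD1.
have := ler_norm (x - y); have := ler_norm (- (x - y)).
rewrite normrN.
rewrite ler_norml; lra.
Qed.

(** By [cnorm_prodB] the products are compared factor by factor. Each quotient is a power of [a i]
    whose exponent, a difference of two floors, is at most [n |v i - v' i| + 1] in absolute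
    value. *)
Lemma lattice_seqB v v' n :
  (N (lattice_seq v n * (lattice_seq v' n)^-1)%g)%:R
    <= A * (n%:R * l1_dist v v' + 1).
Proof.
apply: (@le_trans _ _ (\sum_i (N (a i))%:R * (n%:R * `|v i - v' i| + 1))).
  apply: le_trans (_ : \sum_i (N (zpow (a i) (Num.floor (n%:R * v i)) *
    (zpow (a i) (Num.floor (n%:R * v' i)))^-1)%g)%:R <= _).
    by rewrite -natr_sum ler_nat cnorm_prodB.
  apply: ler_sum => i _; rewrite -zpowB.
  apply: (@le_trans _ _ (`|Num.floor (n%:R * v i) - Num.floor (n%:R * v' i)|%N
     * N (a i))%:R).
    by rewrite ler_nat cnorm_zpow.
  rewrite natrM mulrC ler_wpM2l// natr_absz intr_norm rmorphB.
  apply: le_trans (floor_dist _ _) _.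
  by rewrite -mulrBr normrM normr_nat.
rewrite mulr_suml; apply: ler_sum => i _; rewrite ler_wpM2l// lerD2r.
rewrite ler_wpM2l// /l1_dist (bigD1 i)//= lerDl.
by rewrite sumr_ge0.
Qed.

Lemma scaled_lattice_seqB v v' n : (0 < n)%N ->
  scaled_dist R N (lattice_seq v) (lattice_seq v') n
    <= A * l1_dist v v' + A / n%:R.
Proof.
move=> n0; have n0' : 0 < n%:R :> R by rewrite ltr0n.
rewrite ler_pdivrMr// mulrDl mulfVK ?gt_eqF//.
by apply: le_trans (lattice_seqB v v' n) _; rewrite le_eqVlt; apply/orP; left;
  apply/eqP; ring.
Qed.

Lemma lattice_seq0 n : lattice_seq [ffun=> 0] n = 1%g.
Proof.
by apply: big1 => i _; rewrite ffunE mulr0 floor0.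
Qed.

Lemma scaled_lattice_seq v n : (0 < n)%N ->
  scaled_norm R N (lattice_seq v) n <= A * (l1_dist v [ffun=> 0] + 1).
Proof.
move=> n0; have := scaled_lattice_seqB v [ffun=> 0] n0.
rewrite /scaled_dist /scaled_norm lattice_seq0 invg1 mulg1 => /le_trans; apply.
rewrite mulrDr mulr1 lerD2l ler_piMr// invf_le1 ?ltr0n//.
by rewrite ler1n.
Qed.

Lemma scaled_normM (x y : nat -> H) n :
  scaled_norm R N (fun n => x n * y n)%g n <=
  scaled_norm R N x n + scaled_norm R N y n.
Proof.
by rewrite /scaled_norm -mulrDl ler_wpM2r ?invr_ge0// -natrD ler_nat cnormM.
Qed.

Lemma scaled_normV (x : nat -> H) n :
  scaled_norm R N (fun n => (x n)^-1)%g n = scaled_norm R N x n.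
Proof. by rewrite /scaled_norm cnormV. Qed.

Lemma shifted_admissible (c : adm_seq R D) v :
  admissible R N (fun n => val (val c n) * lattice_seq v n)%g.
Proof.
case: c => c /= /asboolP[B cB].
exists (B + A * (l1_dist v [ffun=> 0] + 1)) => n n0.
rewrite (le_trans (scaled_normM _ _ _))// lerD ?scaled_lattice_seq//.
exact: cB.
Qed.

Definition shifted (c : adm_seq R D) (v : l1space R k) : adm_seq R N :=
  exist (fun x => is_true `[< admissible R N x >]) _
    (asboolT (shifted_admissible c v)).

(** Formed from the chosen representative of [p.1]; by [seq_dist_shifted] any other representative
    yields the same point. *)
Definition cone_join (p : Cone R omega_ultra D * l1space R k) :
  Cone R omega_ultra N := cone_proj omega_ultra (shifted (repr p.1) p.2).

Notation dN := (seq_dist omega (N := N)).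
Notation dD := (seq_dist omega (N := D)).

Lemma mdist_cone_join p q : mdist (cone_join p) (cone_join q) =
  dN (shifted (repr p.1) p.2) (shifted (repr q.1) q.2).
Proof. exact: cone_distE. Qed.

Lemma seq_dist_shifted c c' v v' :
  dN (shifted c v) (shifted c' v') <= dD c c' + A * l1_dist v v'.
Proof.
apply: (le_ultralimit omega_ultra omega_nonprincipal (A := A) _
  (@seq_dist_cvg _ _ omega_ultra _ _ _ _)
  (@seq_dist_cvg _ _ omega_ultra _ _ _ _)) => n n0.
rewrite -addrA; apply: le_trans (lerD (lexx _) (scaled_lattice_seqB v v' n0)).
rewrite /scaled_dist /scaled_norm -mulrDl ler_wpM2r ?invr_ge0//.
by rewrite -natrD ler_nat cnorm_mulB.
Qed.

(** The homomorphism [f i] kills the derived parts, so on the quotient of the two sequences it is a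
    difference of floors, within 1 of [n (v i - v' i)]. The Lipschitz bound [fN] then applies, and
    the error [1 / n] vanishes in the limit. *)
Lemma l1_le_seq_dist c c' v v' :
  l1_dist v v' <= k%:R * C * dN (shifted c v) (shifted c' v').
Proof.
set d := dN _ _.
rewrite [leRHS](_ : _ = \sum_(i < k) C * d); last first.
  by rewrite sumr_const card_ord -[RHS]mulr_natl mulrA.
apply: ler_sum => i _.
have cst_cvg : (fun=> `|v i - v' i|) @ omega --> `|v i - v' i|.
  exact: cvg_cst.
have Cd : (fun n => C * scaled_dist R N (val (shifted c v))
    (val (shifted c' v')) n) @ omega --> C * d.
  by apply: cvgM; [exact: cvg_cst|exact: seq_dist_cvg].
rewrite -[leRHS]addr0; apply: (le_ultralimit omega_ultra omega_nonprincipal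
  (A := 1) _ cst_cvg Cd) => n n0.
have n0' : 0 < n%:R :> R by rewrite ltr0n.
rewrite addr0 /scaled_dist /scaled_norm mulrA -mulrDl ler_pdivlMr//.
set x := (_ * _^-1)%g.
have fx : f i x = (Num.floor (n%:R * v i))%:~R - (Num.floor (n%:R * v' i))%:~R.
  rewrite (real_homB (fM i)) !fM !coord_lattice_seq.
  rewrite !(real_hom_derived (fM i)) ?add0r//.
    exact/asboolP/(valP (val c' n)).
  exact/asboolP/(valP (val c n)).
have := fN i x; rewrite fx.
have := floor_le_tmp (n%:R * v i); have := floorD1_gt (n%:R * v i).
have := floor_le_tmp (n%:R * v' i); have := floorD1_gt (n%:R * v' i).
rewrite !intrD1 => ? ? ? ?.
set y := (X in `|X| <= _) => yle.
have -> : `|v i - v' i| * n%:R = `|n%:R * v i - n%:R * v' i|.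
  by rewrite -mulrBr normrM normr_nat mulrC.
have := ler_norm y; have := ler_norm (- y); rewrite normrN.
rewrite ler_norml /y; move: yle; lra.
Qed.

(** Cancelling the lattice factors costs at most [A * l1_dist v v'], which [l1_le_seq_dist] has
    already bounded by the distance in [H]. *)
Lemma derived_le_seq_dist c c' v v' :
  dD c c' <= (1 + A * (k%:R * C)) * dN (shifted c v) (shifted c' v').
Proof.
rewrite mulrDl mul1r -mulrA.
apply: (@le_trans _ _ (dN (shifted c v) (shifted c' v') + A * l1_dist v v'));
  last by rewrite lerD2l ler_wpM2l// l1_le_seq_dist.
apply: (le_ultralimit omega_ultra omega_nonprincipal (A := A) _
  (@seq_dist_cvg _ _ omega_ultra _ _ _ _)
  (@seq_dist_cvg _ _ omega_ultra _ _ _ _)) => n n0.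
rewrite -addrA; apply: le_trans (lerD (lexx _) (scaled_lattice_seqB v v' n0)).
rewrite /scaled_dist /scaled_norm -mulrDl ler_wpM2r ?invr_ge0//.
rewrite -natrD ler_nat.
set x := fun n => val (val c n); set x' := fun n => val (val c' n).
set s := lattice_seq v n; set s' := lattice_seq v' n.
suff : (N (x n * (x' n)^-1)%g <=
  N (x n * s * (x' n * s')^-1)%g + N (s * s'^-1)%g)%N by [].
have -> : (x n * (x' n)^-1 = (x n * s) * (x' n * s')^-1 *
    (s * s'^-1)^-1 ^ (x' n)^-1)%g.
  by rewrite conjgE !invgM !invgK !mulgA !mulgVK mulgK.
by rewrite (leq_trans (cnormM _ _ _))// cnormJ cnormV.
Qed.

Lemma shifted_surj (x : adm_seq R N) : exists c v, dN (shifted c v) x = 0.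
Proof.
have [w wP] := choice near_derived.
have /asboolP[B xB] := valP x; pose u := val x.
have B0 : 0 <= B by apply: le_trans (xB 1%N isT); rewrite divr_ge0.
(* Boundedness makes the ultralimit below exist; at index 0 the quotient is 0 by the convention on
   division. *)
have fxB i n : `|f i (u n) / n%:R| <= C * B.
  case: n => [|n]; first by rewrite invr0 mulr0 normr0 mulr_ge0.
  rewrite normrM normfV normr_nat.
  apply: le_trans (_ : C * (scaled_norm R N u n.+1) <= _).
    by rewrite mulrA ler_wpM2r.
  by rewrite ler_wpM2l// xB.
pose v : l1space R k := [ffun i => lim ((fun n => f i (u n) / n%:R) @ omega)].
have vP i : (fun n => f i (u n) / n%:R) @ omega --> v i.
  rewrite ffunE; apply: (@ultra_lim_cvg _ _ _ _ (- (C * B)) (C * B)) => n.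
  by rewrite -ler_norml.
(* Once its main direction is removed, the remainder [y] has coordinates of size o(n) along [omega],
   so the correction [w (y n)] moves it into the derived subgroup at negligible cost. *)
pose y n := (u n * (lattice_seq v n)^-1)%g.
pose g n := C * \sum_i `|f i (u n) / n%:R - v i|.
have g0 : g @ omega --> (0 : R).
  rewrite -(mulr0 C); apply: cvgM; first exact: cvg_cst.
  have sum0 : \sum_(i < k) `|v i - v i| = 0.
    by apply: big1 => i _; rewrite subrr normr0.
  rewrite -[X in _ --> X]sum0.
  apply: cvg_big => [|i _]; first exact: add_continuous.
  by apply: cvg_norm; apply: cvgB; [exact: vP|exact: cvg_cst].
(* Convergence of [g] along [omega] would not suffice: admissibility of [c] asks for a bound at
   every positive index. *)
have gB n : g n <= C * \sum_i (C * B + `|v i|).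
  rewrite ler_wpM2l//; apply: ler_sum => i _.
  by rewrite (le_trans (ler_normB _ _))// lerD2r.
(* In the constant [1 + k], the 1 comes from [near_derived] and the [k] from one rounding error per
   coordinate. *)
have wyB n : (0 < n)%N ->
    (N (w (y n)))%:R / n%:R <= g n + C * (1 + k%:R) / n%:R.
  move=> n0; have n0' : 0 < n%:R :> R by rewrite ltr0n.
  rewrite ler_pdivrMr// mulrDl mulfVK ?gt_eqF//.
  apply: le_trans (wP (y n)).2 _.
  rewrite /g -mulrA -mulrDr ler_wpM2l// addrCA lerD2l.
  rewrite [k%:R](_ : _ = \sum_(i < k) 1); last by rewrite sumr_const card_ord.
  rewrite mulr_suml -big_split.
  apply: ler_sum => i _ /=.
  rewrite (real_homB (fM i)) coord_lattice_seq.
  have -> : `|f i (u n) / n%:R - v i| * n%:R = `|f i (u n) - n%:R * v i|.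
    rewrite -{2}(gtr0_norm n0') -normrM mulrBl mulfVK ?gt_eqF//.
    by rewrite [v i * _]mulrC.
  have := floor_le_tmp (n%:R * v i); have := floorD1_gt (n%:R * v i).
  rewrite !intrD1 => ? ?.
  have := ler_norm (f i (u n) - n%:R * v i).
  have := ler_norm (- (f i (u n) - n%:R * v i)); rewrite normrN.
  rewrite ler_norml; lra.
have cD n : `[< derived (y n * (w (y n))^-1)%g >].
  by apply/asboolP; exact: (wP _).1.
pose c n : derived_subgroup H :=
  exist (fun x => is_true `[< derived x >]) _ (cD n).
have c_adm : admissible R D c.
  exists (B + A * (l1_dist v [ffun=> 0] + 1) +
    (C * \sum_i (C * B + `|v i|) + C * (1 + k%:R))) => n n0.
  apply: le_trans (scaled_normM y (fun n => (w (y n))^-1)%g n) _.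
  rewrite scaled_normV lerD//.
    apply: le_trans (scaled_normM _ _ _) _.
    by rewrite scaled_normV lerD ?scaled_lattice_seq// xB.
  apply: le_trans (wyB n n0) _; rewrite lerD//.
  rewrite ler_piMr ?mulr_ge0 ?addr_ge0// invf_le1 ?ltr0n//.
  by rewrite ler1n.
exists (exist (fun x => is_true `[< admissible R D x >]) c (asboolT c_adm)), v.
apply/eqP; rewrite eq_le seq_dist_ge0 andbT -[leRHS]addr0.
apply: (le_ultralimit omega_ultra omega_nonprincipal (A := C * (1 + k%:R)) _
  (@seq_dist_cvg _ _ omega_ultra _ _ _ _) g0) => n n0.
rewrite addr0; apply: le_trans (wyB n n0).
rewrite /scaled_dist /scaled_norm ler_wpM2r ?invr_ge0// ler_nat /=.
(* The lattice factors cancel: the rebuilt sequence differs from [x] only by a conjugate of the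
   inverse correction. *)
have -> : (y n * (w (y n))^-1 * lattice_seq v n * (val x n)^-1 =
    (w (y n))^-1 ^ (y n)^-1)%g.
  by rewrite conjgE /y !invgM !invgK !mulgA.
by rewrite cnormJ cnormV.
Qed.

Theorem cone_split : homeomorphic (Cone R omega_ultra N)
  (Cone R omega_ultra D * l1space R k)%type.
Proof.
(* This is [(1 + A) * (1 + k * C)], which dominates the constants of all three estimates. *)
pose K := 1 + A + k%:R * C + A * (k%:R * C).
have [K1 KA KD KC] :
    [/\ 1 <= K, A <= K, 1 + A * (k%:R * C) <= K & k%:R * C <= K].
  have Kle (x y : R) : 0 <= x -> 0 <= y -> [/\ 1 <= 1 + x + y + x * y,
      x <= 1 + x + y + x * y, 1 + x * y <= 1 + x + y + x * y &
      y <= 1 + x + y + x * y].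
    by move=> x0 y0; have := mulr_ge0 x0 y0; split; lra.
  by apply: Kle; [exact: A_ge0|exact: mulr_ge0].
apply: (@bilipschitz_homeomorphic _ _ _ _ cone_join K).
- move=> p q; rewrite mdist_cone_join.
  apply: le_trans (seq_dist_shifted _ _ _ _) _.
  have d1 := mdist_ge0 p.1 q.1; have d2 := mdist_ge0 p.2 q.2.
  rewrite mulrDr lerD//.
    by rewrite ler_peMl.
  by rewrite ler_wpM2r.
- move=> p q; rewrite mdist_cone_join.
  apply: le_trans (derived_le_seq_dist _ _ p.2 q.2) _.
  by rewrite ler_wpM2r ?seq_dist_ge0.
- move=> p q; rewrite mdist_cone_join.
  apply: le_trans (l1_le_seq_dist (repr p.1) (repr q.1) p.2 q.2) _.
  by rewrite ler_wpM2r ?seq_dist_ge0.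
- move=> q; have [c [v cv]] := shifted_surj (repr q).
  (* [cone_join] uses the representative of the class of [c] instead of [c] itself; the two are at
     distance 0. *)
  exists (cone_proj omega_ultra c, v); rewrite -[RHS]cone_projK.
  apply/cone_projP; apply/eqP; rewrite eq_le seq_dist_ge0 andbT.
  apply: le_trans (seq_distD omega_ultra (shifted c v) _ _) _; rewrite cv addr0.
  apply: le_trans (seq_dist_shifted _ _ _ _) _.
  rewrite l1_distxx mulr0 addr0.
  suff -> : dD (repr (cone_proj omega_ultra c)) c = 0 by [].
  by apply/cone_projP; rewrite cone_projK.
Qed.

End ConeSplitting.

(** * Finitely generated abelian groups *)

Section IntegerSpan.
Variable A : zmodType.
Local Open Scope ring_scope.
Implicit Types (l : seq A) (x y t : A).

Definition lincomb k (s : 'I_k -> A) (c : 'I_k -> int) : A :=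
  \sum_(i < k) s i *~ c i.

Lemma lincombD k (s : 'I_k -> A) c d :
  lincomb s (fun i => c i + d i) = lincomb s c + lincomb s d.
Proof. by rewrite -big_split; apply: eq_bigr => i _; rewrite mulrzDr. Qed.

Lemma lincombB k (s : 'I_k -> A) c d :
  lincomb s (fun i => c i - d i) = lincomb s c - lincomb s d.
Proof. by rewrite -sumrB; apply: eq_bigr => i _; rewrite mulrzBr. Qed.

Lemma lincombM k (s : 'I_k -> A) c n :
  lincomb s (fun i => c i * n) = lincomb s c *~ n.
Proof.
by rewrite /lincomb mulrz_suml; apply: eq_bigr => i _; rewrite mulrzA.
Qed.

Lemma lincomb_delta k (s : 'I_k -> A) j n :
  lincomb s (fun i => n *+ (i == j)) = s j *~ n.
Proof.
rewrite /lincomb (bigD1 j)//= eqxx mulr1n big1 ?addr0// => i ij.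
by rewrite (negPf ij) mulr0n mulr0z.
Qed.

Fixpoint zspan l x : Prop :=
  if l is t :: l' then exists c : int, zspan l' (x - t *~ c) else x = 0.

Lemma zspan0 l : zspan l 0.
Proof. by elim: l => //= t l IHl; exists 0; rewrite mulr0z subrr. Qed.

Lemma zspan_consl t l x : zspan l x -> zspan (t :: l) x.
Proof. by move=> lx; exists 0; rewrite mulr0z subr0. Qed.

Lemma zspanB l x y : zspan l x -> zspan l y -> zspan l (x - y).
Proof.
elim: l x y => [x y -> ->|t l IHl x y [c lx] [d ly]]; first by rewrite subrr.
exists (c - d); have := IHl _ _ lx ly; congr zspan.
by rewrite mulrzBr !opprD !opprK addrACA.
Qed.

Lemma mem_zspan l t : t \in l -> zspan l t.
Proof.
elim: l => [//|u l IHl]; rewrite inE => /orP[/eqP ->|/IHl /zspan_consl]//.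
by exists 1; rewrite mulr1z subrr; exact: zspan0.
Qed.

Definition zindependent k (s : 'I_k -> A) :=
  forall c, lincomb s c = 0 -> forall i, c i = 0.

(** For nonzero [M], every element of the span of [l] is torsion modulo the span of [s]. *)
Definition virtually_spans k (s : 'I_k -> A) (M : int) l :=
  forall x, zspan l x -> exists c, x *~ M = lincomb s c.

(** Generators are added one at a time. If a nonzero multiple [t *~ n] lies in the span of [s], then
    [s] is kept and [M] becomes [M * n]; otherwise [t] joins [s]. *)
Lemma exists_independent l : exists k (s : 'I_k -> A) (M : int),
  [/\ M != 0, zindependent s & virtually_spans s M l].
Proof.
elim: l => [|t l [k [s [M [M0 s_ind s_span]]]]].
  exists 0%N, (fun=> 0), 1; split=> // [c _ []//|x ->].
  by exists (fun=> 0); rewrite mulr1z /lincomb big_ord0.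
have [[n [c [n0 tn]]]|t_ind] :=
    pselect (exists n c, n != 0 /\ t *~ n = lincomb s c).
  exists k, s, (M * n); split=> //; first by rewrite mulf_neq0.
  move=> x [a /s_span[d xd]]; exists (fun i => d i * n + c i * (a * M)).
  rewrite lincombD !lincombM -tn -xd -!mulrzA.
  by rewrite mulrzBl -mulrzA [n * _]mulrC -[a * M * n]mulrA subrK.
pose s' i := if unlift ord0 i is Some j then s j else t.
have lincombS c : lincomb s' c =
    t *~ c ord0 + lincomb s (fun i => c (lift ord0 i)).
  rewrite /lincomb big_ord_recl /s' unlift_none; congr (_ + _).
  by apply: eq_bigr => i _; rewrite liftK.
exists k.+1, s', M; split=> //.
  move=> c; rewrite lincombS => c0.
  have c00 : c ord0 = 0.
    apply/eqP/negPn/negP => cn0; apply: t_ind.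
    exists (- c ord0), (fun i => c (lift ord0 i)).
    rewrite oppr_eq0 cn0 mulrNz; split=> //.
    by apply/esym/eqP; rewrite -addr_eq0 addrC c0.
  move: c0; rewrite c00 mulr0z add0r => /s_ind cl i.
  by case: (unliftP ord0 i) => [j ->|->].
move=> x [a /s_span[d xd]].
exists (fun i => if unlift ord0 i is Some j then d j else a * M).
rewrite lincombS unlift_none.
transitivity (t *~ (a * M) + lincomb s d).
  by rewrite -xd mulrzBl mulrzA addrC subrK.
by congr (_ + _); apply: eq_bigr => i _; rewrite liftK.
Qed.

(** Since [t *~ M] lies in the span of [s], the coefficient of each generator [t] matters only
    modulo [M]. *)
Lemma finite_residues l k (s : 'I_k -> A) (M : int) : M != 0 ->
  virtually_spans s M l -> exists B : seq A, forall x, zspan l x ->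
    exists2 r, r \in B & exists c, x = r + lincomb s c.
Proof.
move=> M0; elim: l => [_|t l IHl s_span].
  exists [:: 0] => x ->; exists 0; first by rewrite mem_head.
  by exists (fun=> 0); rewrite /lincomb big1 ?addr0// => i _; rewrite mulr0z.
have [B BP] : exists B : seq A, forall x, zspan l x ->
    exists2 r, r \in B & exists c, x = r + lincomb s c.
  by apply: IHl => x /(zspan_consl t) /s_span.
have [d td] : exists d, t *~ M = lincomb s d.
  by apply/s_span/mem_zspan; rewrite mem_head.
exists [seq t *+ n + r | n <- iota 0 `|M|%N, r <- B] => x [a /BP[r rB [c xE]]].
have [n nM aE] : exists2 n : nat, (n < `|M|)%N & a = (a %/ M)%Z * M + n%:Z.
  exists `|(a %% M)%Z|%N.
    by rewrite -ltz_nat gez0_abs ?modz_ge0// ltz_mod.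
  by rewrite gez0_abs ?modz_ge0// -divz_eq.
exists (t *+ n + r).
  by apply/allpairsP; exists (n, r); split=> //=; rewrite mem_iota.
exists (fun i => c i + d i * (a %/ M)%Z).
rewrite lincombD lincombM -td -mulrzA [M * _]mulrC.
have -> : x = t *~ a + (r + lincomb s c) by rewrite -xE addrC subrK.
rewrite {1}aE mulrzDr [t *~ (_ * M) + _]addrC -!addrA; congr (_ + _).
by rewrite addrC -addrA.
Qed.

(** Independence makes the coefficients of [x *~ M] unique, hence additive in [x]. Division by [M]
    is postponed so that [e] stays integer valued and serves both the real coordinates and the
    rational tensor product. *)
Lemma finitely_generated_coordinates l : (forall x, zspan l x) ->
  exists k (s : 'I_k -> A) (M : int) (e : 'I_k -> A -> int) (B : seq A),
  [/\ M != 0, (forall i x y, e i (x + y) = e i x + e i y),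
      (forall i j, e i (s j) = M *+ (i == j)),
      (forall x, x *~ M = lincomb s (e^~ x)) &
      (forall x, exists2 r, r \in B & exists c, x = r + lincomb s c)].
Proof.
move=> lA; have [k [s [M [M0 s_ind s_span]]]] := exists_independent l.
have [B BP] := finite_residues M0 s_span.
have /choice[e eP] : forall x, exists c, x *~ M = lincomb s c.
  by move=> x; exact: s_span.
have e_uniq c d : lincomb s c = lincomb s d -> forall i, c i = d i.
  move=> cd i; apply/eqP; rewrite -subr_eq0.
  by apply/eqP/(s_ind (fun i => c i - d i)); rewrite lincombB cd subrr.
exists k, s, M, (fun i x => e x i), B; split=> // [i x y|i j|x].
- move: i; apply: e_uniq.
  by rewrite lincombD -!eP mulrzDl.
- by move: i; apply: e_uniq; rewrite -eP lincomb_delta.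
- exact/BP/lA.
Qed.

End IntegerSpan.

(** * The rank as a tensor dimension *)

Section Dimension.
Variables (K : fieldType) (V : lmodType K).
Local Open Scope ring_scope.

(** Expanding each basis in the other gives matrices with [P *m Q] the identity of size [k], which
    cannot factor through a smaller size. *)
Lemma is_basis_leq k k' (b : 'I_k -> V) (b' : 'I_k' -> V) :
  is_basis b -> is_basis b' -> (k <= k')%N.
Proof.
move=> b_basis b'_basis.
have /choice[p pP] : forall i, exists c : {ffun 'I_k' -> K},
    b i = \sum_j c j *: b' j.
  by move=> i; have [c [? _]] := b'_basis (b i); exists c.
have /choice[q qP] : forall j, exists c : {ffun 'I_k -> K},
    b' j = \sum_i c i *: b i.
  by move=> j; have [c [? _]] := b_basis (b' j); exists c.
pose P := \matrix_(i, j) p i j; pose Q := \matrix_(j, i) q j i.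
apply: (@mulmx1_min _ _ _ P Q); apply/matrixP => i l.
have [c [_ c_uniq]] := b_basis (b i).
have cPQ : c = [ffun l => (P *m Q) i l].
  apply: c_uniq; rewrite [LHS]pP.
  under eq_bigr do rewrite qP scaler_sumr.
  rewrite exchange_big; apply: eq_bigr => m _.
  rewrite ffunE mxE scaler_suml; apply: eq_bigr => j _.
  by rewrite !mxE scalerA.
have c1 : c = [ffun l => (i == l)%:R].
  apply: c_uniq; rewrite (bigD1 i)//= ffunE eqxx scale1r big1 ?addr0// => m mi.
  by rewrite ffunE eq_sym (negPf mi) scale0r.
by move: cPQ; rewrite c1 => /ffunP /(_ l); rewrite !ffunE !mxE.
Qed.

Lemma dimension_basis k (b : 'I_k -> V) : is_basis b -> dimension V = k.
Proof.
move=> b_basis; apply: xget_unique; first by exists b.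
move=> k' [b' b'_basis]; apply/eqP.
rewrite eqn_leq (is_basis_leq b_basis b'_basis).
by rewrite (is_basis_leq b'_basis b_basis).
Qed.

End Dimension.

Section AdditiveCopy.
Variables (A : groupType) (mulAC : forall x y : A, (x * y = y * x)%g).

(* A written additively, so that MathComp's integer multiples and linear     *)
(* structures apply; the carrier stays convertible to A.                      *)
Definition additive_copy of (forall x y : A, (x * y = y * x)%g) : Type := A.
Local Notation Z := (additive_copy mulAC).

HB.instance Definition _ := Choice.on Z.
HB.instance Definition _ := GRing.isZmodule.Build Z
  (@mulgA A) mulAC (@mul1g A) (@mulVg A).

Local Open Scope ring_scope.

Definition tens_left (q : rat) (x : Z) : tensQ A := tens (x : A) q.

Lemma tens_left_is_additive q : zmod_morphism (tens_left q).
Proof.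
have tD (x y : Z) : tens_left q (x + y) = tens_left q x + tens_left q y.
  exact: tensDl.
by move=> x y; apply/eqP; rewrite eq_sym subr_eq -tD subrK.
Qed.

HB.instance Definition _ q :=
  GRing.isZmodMorphism.Build Z (tensQ A) (tens_left q)
    (tens_left_is_additive q).

(* Separates the symbols tens (s i) 1: a homomorphism e to the integers       *)
(* extends to a functional on formal sums that respects tens_eq.              *)
Definition tens_coord (e : Z -> int) (v : seq (A * rat)) : rat :=
  \sum_(x <- v) (e x.1)%:~R * x.2.

Lemma tens_coord_eq e v w : (forall x y, e (x + y) = e x + e y) ->
  tens_eq v w -> tens_coord e v = tens_coord e w.
Proof.
move=> eD; rewrite /tens_coord; elim=> {v w} //.
- by move=> v w u _ -> _ ->.
- by move=> v v' w w' _ vv _ ww; rewrite !big_cat vv ww.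
- by move=> v w; rewrite !big_cat /= addrC.
- by move=> a; rewrite big_seq1 big_nil mulr0.
- by move=> a b q; rewrite !big_cons big_nil /= !addr0 -mulrDl -intrD -eD.
- by move=> a p q; rewrite !big_cons big_nil /= !addr0 mulrDr.
Qed.

Variables (k : nat) (s : 'I_k -> Z) (M : int) (e : 'I_k -> Z -> int).
Hypothesis M_neq0 : M != 0.
Hypothesis eD : forall i x y, e i (x + y) = e i x + e i y.
Hypothesis es : forall i j, e i (s j) = M *+ (i == j).
Hypothesis eE : forall x, x *~ M = lincomb s (e^~ x).

Let MQ : M%:~R != 0 :> rat. Proof. by rewrite intr_eq0. Qed.

Let b i : tensQ A := tens (s i : A) 1.

Lemma tclass_cat (v w : seq (A * rat)) :
  tclass (v ++ w) = tclass v + tclass w.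
Proof. by rewrite [RHS]taddE. Qed.

Lemma tens_basis_seq (c : {ffun 'I_k -> rat}) :
  \sum_i c i *: b i = tclass [seq ((s i : A), c i) | i <- index_enum 'I_k].
Proof.
elim: (index_enum _) => [|i r IHr]; first by rewrite big_nil.
by rewrite big_cons IHr tensZ mulr1 /= -cat1s tclass_cat.
Qed.

Lemma coord_tens_basis_seq i (c : {ffun 'I_k -> rat}) :
  tens_coord (e i) [seq ((s i : A), c i) | i <- index_enum 'I_k] = M%:~R * c i.
Proof.
rewrite /tens_coord big_map (bigD1 i)//= es eqxx big1 ?addr0// => j ji.
by rewrite es eq_sym (negPf ji) mul0r.
Qed.

(** After multiplication by [M], invertible in the rationals, [a] becomes an integer combination of
    the [s i]; torsion thereby disappears. *)
Lemma tens_expand (a : Z) q :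
  tens (a : A) q = \sum_i (((e i a)%:~R * q) / M%:~R) *: b i.
Proof.
apply: (can_inj (scalerK MQ)); rewrite scaler_sumr.
transitivity (tens_left q (a *~ M)); first by rewrite raddfMz scaler_int.
rewrite eE raddf_sum; apply: eq_bigr => i _.
rewrite raddfMz -scaler_int /tens_left !tensZ mulr1; congr tens.
by rewrite [RHS]mulrC divfK.
Qed.

(** Existence is by induction on the formal sum; for uniqueness, the functionals [tens_coord (e i)]
    recover [M] times each coefficient. *)
Lemma tens_basis : is_basis b.
Proof.
move=> v; have [c vc] : exists c : {ffun 'I_k -> rat}, v = \sum_i c i *: b i.
  rewrite -[v]tclassK; elim: (repr v) => [|[a q] w [c IHw]].
    exists [ffun=> 0]; rewrite big1// => i _; by rewrite ffunE scale0r.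
  exists [ffun i => ((e i a)%:~R * q) / M%:~R + c i].
  rewrite -cat1s tclass_cat IHw -[tclass [:: (a, q)]]/(tens a q) tens_expand.
  rewrite -big_split; apply: eq_bigr => i _.
  by rewrite ffunE scalerDl.
exists c; split=> // d; rewrite vc !tens_basis_seq => /tclassP cd.
apply/ffunP => i; have := tens_coord_eq (eD i) cd.
by rewrite !coord_tens_basis_seq => /(mulfI MQ).
Qed.

Lemma ab_rankE : ab_rank A = k.
Proof. exact: dimension_basis tens_basis. Qed.

End AdditiveCopy.

(** * Conclusion *)

Section FinitelyManyConjugacyClasses.
Local Open Scope ring_scope.

(** A real homomorphism is constant on conjugacy classes, so it takes finitely many values on [T];
    summing their absolute values over representatives bounds each letter of a word. *)
Lemma word_norm_hom_bound (R : realType) (G : groupType) (T : set G)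
    (hT : fin_conj_gen T) (f : G -> R) :
    (forall x y, f (x * y)%g = f x + f y) ->
  exists2 C : R, 0 <= C & forall x, `|f x| <= C * (word_norm hT x)%:R.
Proof.
move=> fM; have [_ _ [F /finite_seqP[r ->] TE]] := hT.
exists (\sum_(y <- r) `|f y|) => [|x]; first exact: sumr_ge0.
have fT t : T t -> `|f t| <= \sum_(y <- r) `|f y|.
  rewrite TE => -[y /= yr [g _ <-]]; rewrite real_homJ//.
  by rewrite (big_rem y)//= lerDl sumr_ge0.
have [[w [<- wT ->]] _] := word_normP hT x.
elim: w wT => [|t w IHw] wT; first by rewrite big_nil real_hom1// normr0 mulr0.
rewrite big_cons fM (le_trans (ler_normD _ _))// -natr1 mulrDr mulr1 addrC.
rewrite lerD//; first by apply: IHw => z zw; apply: wT; rewrite inE zw orbT.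
by apply/fT/wT; rewrite mem_head.
Qed.

Variables (A : groupType) (mulAC : forall x y : A, (x * y = y * x)%g).

Lemma fin_conj_gen_zspan (S : set A) : fin_conj_gen S ->
  exists l : seq (additive_copy mulAC), forall x, zspan l x.
Proof.
move=> [_ S_gen [F /finite_seqP[l ->] SE]]; exists l => x.
have : generated S x by rewrite S_gen.
move=> /(_ (zspan (l : seq (additive_copy mulAC)))); apply; split; last first.
  move=> t; rewrite SE => -[y /= yl [g _ <-]].
  (* Conjugation is trivial in a commutative group, so the finite set of representatives already
     generates. *)
  by rewrite conjgE mulAC -mulgA mulgV mulg1; exact: mem_zspan.
pose Z := additive_copy mulAC.
split=> [|y z ly lz|y ly]; first exact: (@zspan0 Z).
- have := @zspanB Z l y (0 - (z : Z)) ly (zspanB (zspan0 _) lz).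
  by rewrite sub0r opprK.
- by have := @zspanB Z l 0 y (zspan0 _) ly; rewrite sub0r.
Qed.

End FinitelyManyConjugacyClasses.

(** * From integer coordinates on the abelianization to the cone splitting *)

Section SplittingFromCoordinates.
Variables (R : realType) (omega : set_system nat).
Variable omega_ultra : UltraFilter omega.
Hypothesis omega_nonprincipal : forall n : nat, omega <> principal_filter n.
Variables (H : groupType) (N : conj_norm H).
Local Open Scope ring_scope.
Hypothesis N_hom_bound : forall f : H -> R,
  (forall x y, f (x * y)%g = f x + f y) ->
  exists2 C : R, 0 <= C & forall x, `|f x| <= C * (N x)%:R.
(** [p] models the abelianization map and [lift] a set-theoretic section, so that one argument
    covers both [ab_proj] on [G] and the identity on the abelianization. *)
Variables (Z : zmodType) (p : H -> Z) (lift : Z -> H).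
Hypothesis pM : forall x y, p (x * y)%g = p x + p y.
Hypothesis p_ker : forall x y, p x = p y -> derived (x * y^-1)%g.
Hypothesis liftK : cancel lift p.
Variables (k : nat) (s : 'I_k -> Z) (M : int) (e : 'I_k -> Z -> int).
Variable B : seq Z.
Hypothesis M_neq0 : M != 0.
Hypothesis eD : forall i x y, e i (x + y) = e i x + e i y.
Hypothesis es : forall i j, e i (s j) = M *+ (i == j).
Hypothesis B_residues :
  forall x, exists2 r, r \in B & exists c, x = r + lincomb s c.

Let MR : M%:~R != 0 :> R. Proof. by rewrite intr_eq0. Qed.

Let p1 : p 1%g = 0.
Proof. by apply: (addrI (p 1%g)); rewrite -pM mulg1 addr0. Qed.

Let pV x : p x^-1%g = - p x.
Proof. by apply/eqP; rewrite -addr_eq0 -pM mulVg p1. Qed.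

Let p_zpow g z : p (zpow g z) = p g *~ z.
Proof.
have pX n : p (g ^+ n)%g = p g *+ n.
  by elim: n => [|n IHn]; rewrite ?expg0 ?p1// expgS pM IHn mulrS.
by case: z => n /=; rewrite ?pV pX.
Qed.

Let f i x : R := (e i (p x))%:~R / M%:~R.

Let fM i x y : f i (x * y)%g = f i x + f i y.
Proof. by rewrite /f pM eD intrD mulrDl. Qed.

Lemma coord_residue i r c :
  (e i (r + lincomb s c))%:~R / M%:~R = (e i r)%:~R / M%:~R + (c i)%:~R :> R.
Proof.
have e0 : e i 0 = 0 by apply: (addrI (e i 0)); rewrite -eD !addr0.
have eN x : e i (- x) = - e i x by apply/eqP; rewrite -addr_eq0 -eD addNr e0.
have eMn x n : e i (x *+ n) = e i x *+ n.
  by elim: n => [|n IHn]; rewrite ?mulr0n ?e0// !mulrS eD IHn.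
have eMz x n : e i (x *~ n) = e i x * n.
  case: n => n; rewrite ?NegzE ?mulrNz ?eN ?mulrN;
    by rewrite -pmulrn eMn -mulr_natr ?natz.
rewrite eD intrD mulrDl; congr (_ + _).
rewrite /lincomb (big_morph _ (eD i) e0) (bigD1 i)//= big1 => [|j ji].
  by rewrite addr0 eMz es eqxx intrM mulrC mulKf.
by rewrite eMz es eq_sym (negPf ji) mul0r.
Qed.

Lemma cone_split_coordinates : homeomorphic (Cone R omega_ultra N)
  (Cone R omega_ultra (restr_norm N) * l1space R k)%type.
Proof.
have /choice[Cf CfP] : forall i, exists C, 0 <= C /\
    forall x, `|f i x| <= C * (N x)%:R.
  by move=> i; have [C C0 fC] := N_hom_bound (fM i); exists C.
pose a j := lift (s j); pose A : R := \sum_j (N (a j))%:R.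
(* [h r] bounds the cost of the residue [r]; summing over the finite list [B] gives one constant for
   all residues, and adding the [Cf i] lets the same [C] serve as Lipschitz bound. *)
pose h r : R := (N (lift r))%:R + A * \sum_j `|(e j r)%:~R / M%:~R|.
pose C : R := \sum_i Cf i + (\sum_(r <- B) h r + A).
have A0 : 0 <= A by exact: sumr_ge0.
have h0 r : 0 <= h r by rewrite addr_ge0// mulr_ge0// sumr_ge0.
have Cf0 : 0 <= \sum_i Cf i by apply: sumr_ge0 => i _; have [] := CfP i.
have Bh0 : 0 <= \sum_(r <- B) h r by exact: sumr_ge0.
apply: (@cone_split _ _ _ omega_nonprincipal _ _ _ f a C) => //.
- move=> i j; rewrite /f /a liftK es; case: (i == j); last by rewrite mul0r.
  by rewrite divff.
- by rewrite addr_ge0// addr_ge0.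
- move=> i x; have [Ci0 /(_ x) /le_trans] := CfP i; apply.
  rewrite ler_wpM2r//; apply: (@le_trans _ _ (\sum_i Cf i)); last first.
    by rewrite lerDl addr_ge0.
  rewrite (bigD1 i)//= lerDl; apply: sumr_ge0 => j _.
  by have [] := CfP j.
move=> x; have [r rB [c xE]] := B_residues (p x).
(* This element has the same image as [x] under [p], and its exponents [c j] equal [f j x] up to a
   term depending only on [r]. *)
exists (lift r * \prod_j zpow (a j) (c j))%g; split.
  apply: p_ker; rewrite xE pM liftK (big_morph _ pM p1); congr (_ + _).
  by apply: eq_bigr => j _; rewrite p_zpow liftK.
have cE j : (c j)%:~R = f j x - (e j r)%:~R / M%:~R.
  by rewrite /f xE coord_residue addrAC subrr add0r.
have Nprod : (N (\prod_j zpow (a j) (c j))%g)%:R <=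
    A * \sum_j `|(c j)%:~R| :> R.
  apply: (@le_trans _ _ (\sum_j (N (a j))%:R * `|(c j)%:~R|)).
    apply: le_trans (_ : (\sum_j N (zpow (a j) (c j)))%:R <= _).
      by rewrite ler_nat cnorm_prod.
    rewrite natr_sum; apply: ler_sum => j _.
    rewrite -intr_norm -natr_absz mulrC -natrM ler_nat.
    exact: cnorm_zpow.
  rewrite mulr_suml; apply: ler_sum => j _; rewrite ler_wpM2l//.
  by rewrite (bigD1 j)//= lerDl sumr_ge0.
apply: (@le_trans _ _ (h r + A * \sum_j `|f j x|)).
  apply: (@le_trans _ _ ((N (lift r))%:R + A * \sum_j `|(c j)%:~R|)).
    by apply: le_trans (lerD (lexx _) Nprod); rewrite -natrD ler_nat cnormM.
  rewrite -addrA lerD2l -mulrDr ler_wpM2l// -big_split.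
  apply: ler_sum => j _ /=.
  by rewrite cE addrC ler_normB.
have hr : h r <= \sum_(r <- B) h r by rewrite (big_rem r)//= lerDl sumr_ge0.
have F0 : 0 <= \sum_j `|f j x| by exact: sumr_ge0.
rewrite /C mulrDr mulr1 lerD//.
  by apply: le_trans hr _; rewrite addrCA lerDl addr_ge0.
by rewrite ler_wpM2r// addrA lerDr addr_ge0.
Qed.

End SplittingFromCoordinates.

Section CommutativeGroups.
Local Open Scope group_scope.

Lemma abelianization_mulC (G : groupType) (x y : abelianization G) :
  x * y = y * x.
Proof.
rewrite -(ab_projK x) -(ab_projK y).
change (ab_mul (ab_proj (repr x)) (ab_proj (repr y)) =
  ab_mul (ab_proj (repr y)) (ab_proj (repr x))).
rewrite -!ab_projM; apply/ab_projP.
move: (repr x) (repr y) => {}x {}y; rewrite invgM mulgA.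
(* The quotient of [x * y] by [y * x] is the commutator of the inverses. *)
have := commg_derived x^-1 y^-1.
by rewrite commgEl conjgE !invgK !mulgA.
Qed.

Lemma derived_commutative (A : groupType) (x : A) :
  (forall y z : A, y * z = z * y) -> derived x -> x = 1.
Proof.
move=> AC Dx; apply: (Dx [set 1]); split; last first.
  by move=> _ [y _ [z _ <-]]; rewrite /= commgEl conjgE (AC y) mulKg mulVg.
by split=> [|_ _ -> ->|_ ->] //=; rewrite ?mulg1 ?invg1.
Qed.

End CommutativeGroups.

Lemma trivial_group_cone (R : realType) (omega : set_system nat)
    (omega_ultra : UltraFilter omega) (G : groupType) (N : conj_norm G) :
  (forall x : G, x = 1%g) -> exists q0 : Cone R omega_ultra N, forall q, q = q0.
Proof.
move=> G1; have adm1 : admissible R N (fun=> 1%g).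
  by exists 0%R => n _; rewrite /scaled_norm cnorm1 mul0r.
exists (cone_proj omega_ultra
  (exist (fun x => is_true `[< admissible R N x >]) _ (asboolT adm1))) => q.
rewrite -[LHS]cone_projK; congr cone_proj; apply/val_inj/funext => n.
by rewrite [LHS]G1 [RHS]G1.
Qed.

Theorem proposition3p11 (R : realType)
    (omega : set_system nat) (omega_ultra : UltraFilter omega)
    (omega_nonprincipal : forall n : nat, omega <> principal_filter n)
    (G : groupType)
    (T : set G) (hT : fin_conj_gen T)
    (S : set (abelianization G)) (hS : fin_conj_gen S) :
  homeomorphic
    (Cone R omega_ultra (word_norm hT))
    (Cone R omega_ultra (restr_norm (word_norm hT)) *
     Cone R omega_ultra (word_norm hS))%type
  /\
  homeomorphic
    (Cone R omega_ultra (restr_norm (word_norm hT)) *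
     Cone R omega_ultra (word_norm hS))%type
    (Cone R omega_ultra (restr_norm (word_norm hT)) *
     l1space R (ab_rank (abelianization G)))%type.
Proof.
have mulAC := @abelianization_mulC G.
have [l lS] := fin_conj_gen_zspan mulAC hS.
have [k [s [M [e [B [M0 eD es eE BP]]]]]] := finitely_generated_coordinates lS.
(* The number of coordinates is the rank, so both splittings below share the same [k]. *)
rewrite (ab_rankE M0 eD es eE).
have split_G : homeomorphic (Cone R omega_ultra (word_norm hT))
    (Cone R omega_ultra (restr_norm (word_norm hT)) * l1space R k)%type.
  apply: (cone_split_coordinates omega_ultra omega_nonprincipal
    (Z := additive_copy mulAC) (p := @ab_proj G) (lift := repr)
    _ _ _ _ M0 eD es BP) => //.
  - exact: word_norm_hom_bound.
  - exact: ab_projM.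
  - by move=> x y /ab_projP.
  - exact: ab_projK.
have split_ab : homeomorphic (Cone R omega_ultra (word_norm hS)) (l1space R k).
  have triv (x : derived_subgroup (abelianization G)) : x = 1%g.
    apply: val_inj; rewrite val1.
    exact: derived_commutative mulAC (asboolW (valP x)).
  have [q0 q0P] :=
    trivial_group_cone R omega_ultra (restr_norm (word_norm hS)) triv.
  (* The derived subgroup of the abelianization is trivial, so its cone is a point and drops out of
     the product. *)
  apply: homeomorphic_trans (homeomorphic_prod_point _ q0P).
  apply: (cone_split_coordinates omega_ultra omega_nonprincipal
    (Z := additive_copy mulAC) (p := id) (lift := id)
    _ _ _ _ M0 eD es BP) => //.
  - exact: word_norm_hom_bound.
  - have [D1 _ _] : is_subgroup (@derived (abelianization G)).
      exact: generated_subgroup.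
    by move=> x y ->; rewrite mulgV.
have split_prod := homeomorphic_prodr
  (Cone R omega_ultra (restr_norm (word_norm hT))) split_ab.
split=> //.
exact: homeomorphic_trans split_G (homeomorphic_sym split_prod).
Qed.
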